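(* Let $(a_n,b_n)$, $n\ge1$, be the $P$-positions $(x,y)$ with $0<x\le y$ of Corner the 2-Queen Dee, listed so that $a_1<a_2<\cdots$. Then for every $n\ge1$, $$a_{b_n}=a_n+b_n\quad\text{or}\quad a_{b_n}=a_n+b_n-1.$$
   Context: Positions are pairs $(x,y)$ of nonnegative integers. From $(x,y)$ the 2-Queen Dee may move to any position different from $(x,y)$ among: (i) $(x',y)$ with $0\le x'<x$, or $(x,y')$ with $0\le y'<y$; (ii) for each starting point $(u,v)\in\{(x,y),(x-1,y),(x,y-1)\}$ with $u,v\ge0$: the positions $(u-s,v-s)$ with $0\le s\le\min(u,v)$, and, if $u<v$, the positions $(t,v-u-t)$ with $0<t\le v-u$, and, if $u>v$, the positions $(u-v-t,t)$ with $0<t\le u-v$. Every move strictly decreases $x+y$. $P$-positions: $(0,0)$ is a $P$-position, and a position is a $P$-position iff it has no move to a $P$-position. *)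

(* Defs.v *)
From Stdlib Require Import Classical.
From mathcomp Require Import all_boot.
From mathcomp Require Import zify.

Set Implicit Arguments.
Unset Strict Implicit.
Unset Printing Implicit Defensive.

Definition position : Type := nat * nat.

Definition rook_move (p q : position) : Prop :=
  (q.1 < p.1 /\ q.2 = p.2) \/ (q.1 = p.1 /\ q.2 < p.2).

(* [w] is [p] itself, or [p] shifted one step left or one step down; the
   successors avoid truncated subtraction at the border of the board. *)
Definition starting_point (p w : position) : Prop :=
  [\/ w = p, p = (w.1.+1, w.2) | p = (w.1, w.2.+1)].

(* The diagonal through [w] down to the border (s = 0 gives [w] itself), and
   its reflection there along an antidiagonal. *)
Definition reflected_diagonal (w q : position) : Prop :=
  let: (u, v) := w in
  [\/ exists s, s <= minn u v /\ q = (u - s, v - s),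
      u < v /\ (exists t, 0 < t <= v - u /\ q = (t, v - u - t))
    | v < u /\ (exists t, 0 < t <= u - v /\ q = (u - v - t, t))].

Definition move (p q : position) : Prop :=
  q <> p /\
  (rook_move p q \/ exists w, starting_point p w /\ reflected_diagonal w q).

(* An edge position may reflect to a position with the same coordinate sum, so
   [move] is not well-founded: (0, y) and (y, 0) are mutually reachable.  This
   is harmless, as such a position also has a rook move to (0, 0): by
   [P_positionE] and [P_position_unique] below, [P_position] is the only
   solution of the usual defining equation. *)
Inductive P_position (p : position) : Prop :=
  | P_intro : (forall q, move p q -> N_position q) -> P_position p
with N_position (p : position) : Prop :=
  | N_intro : forall q, move p q -> P_position q -> N_position p.

Lemma no_move0 q : ~ move (0, 0) q.
Proof.
case: q => [x' y'] [neq_q0].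
case=> [|[[u v] [start]]]; first by rewrite /rook_move /=; lia.
have {start} [-> ->] : u = 0 /\ v = 0 by case: start => -[].
by case=> [[s [_ eq_q]]|[]//|[]//]; apply: neq_q0; rewrite eq_q !sub0n.
Qed.

Lemma move_decreases p q :
  move p q -> q.1 + q.2 < p.1 + p.2 \/ move p (0, 0).
Proof.
case: p q => [x y] [x' y'] mv_pq.
have [[x0 y0]|[edge|[x_gt0 y_gt0]]] :
    (x = 0 /\ y = 0) \/ ((x = 0 /\ 0 < y \/ y = 0 /\ 0 < x) \/ (0 < x /\ 0 < y)).
  by lia.
- by move: mv_pq; rewrite x0 y0 => /no_move0.
- by right; split; [case: edge => -[-> ?] [?]; lia | left; rewrite /rook_move /=; lia].
left; case: mv_pq => neq_qp.
have {}neq_qp : x' <> x \/ y' <> y.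
  have [eq_x|/eqP] := eqVneq x' x; last by left.
  by right=> eq_y; apply: neq_qp; rewrite eq_x eq_y.
case=> [|[[u v] [start]]]; first by rewrite /rook_move /=; lia.
have {}start : [\/ u = x /\ v = y, x = u.+1 /\ y = v | x = u /\ y = v.+1].
  by case: start => -[-> ->]; [apply: Or31 | apply: Or32 | apply: Or33].
case=> [[s [le_s [ex ey]]] | [lt_uv [t [le_t [ex ey]]]]
       | [lt_vu [t [le_t [ex ey]]]]] /=;
  case: start => -[] *; lia.
Qed.

Lemma P_position0 : P_position (0, 0).
Proof. by constructor=> q /no_move0. Qed.

Lemma P_positionE p :
  P_position p <-> ~ exists q, move p q /\ P_position q.
Proof.
have [m] := ubnP (p.1 + p.2); elim: m p => // m IHm p lt_pm.
have [p0|np0] := classic (move p (0, 0)).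
  split=> [[/(_ _ p0)[q /no_move0]] //|[]].
  by exists (0, 0); split=> //; apply: P_position0.
have IH q : move p q -> P_position q <-> ~ exists r, move q r /\ P_position r.
  by move=> /move_decreases[lt_qp|//]; apply: IHm; exact: leq_trans lt_qp lt_pm.
split=> [[allN] [q [pq Pq]] | noP].
  have [r qr Pr] := allN q pq.
  by case: (IH q pq) => /(_ Pq) noPr _; apply: noPr; exists r.
constructor=> q pq; apply: NNPP => notN; apply: noP; exists q; split=> //.
by apply/(IH q pq) => -[r [qr Pr]]; apply: notN; exact: N_intro qr Pr.
Qed.

Lemma P_position_unique (P : position -> Prop) :
  (forall p, P p <-> ~ exists q, move p q /\ P q) ->
  forall p, P p <-> P_position p.
Proof.
move=> PE p; have [m] := ubnP (p.1 + p.2); elim: m p => // m IHm p lt_pm.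
rewrite PE P_positionE; have [p0|np0] := classic (move p (0, 0)).
  split=> [][]; exists (0, 0); split=> //; last exact: P_position0.
  by apply/PE => -[q [/no_move0]].
have IH q : move p q -> P q <-> P_position q.
  by move=> /move_decreases[lt_qp|//]; apply: IHm; exact: leq_trans lt_qp lt_pm.
by split=> noP [q [pq Pq]]; apply: noP; exists q; split=> //; apply/(IH q pq).
Qed.

(* Indexing starts at 1: the values [a 0] and [b 0] are irrelevant. *)
Definition lists_P_positions (a b : nat -> nat) : Prop :=
  [/\ forall n, 0 < n -> P_position (a n, b n) /\ 0 < a n <= b n,
      forall x y, P_position (x, y) -> 0 < x <= y ->
        exists n, [/\ 0 < n, a n = x & b n = y]
    & forall m n, 0 < m -> m < n -> a m < a n].

(* Main.v *)
From Stdlib Require Import Classical.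
Require Import Defs.
From mathcomp Require Import all_boot.
From mathcomp Require Import zify.

Set Implicit Arguments.
Unset Strict Implicit.
Unset Printing Implicit Defensive.

(* With d = (b - a) / 2, the reflections forbid two P-positions with close
   differences, or with a difference close to a sum.  Hence the P-positions are
   determined by two conditions: a and b = a + 2d are complementary sequences,
   and so are d and a + d.  These are solved by the Tribonacci word, the fixed
   point of 0 -> 01, 1 -> 02, 2 -> 0.  Let y n and z n count the letters 0 and 1
   among its first n letters, and let f n be the length of the image of these n
   letters; up to a shift of indices, d n = n + y n and a n = n + z n.  As the
   (n+1)-st 0 and 1 are at f n and f (f n) + 1, Lambek-Moser gives the two
   complementarities, with b n = f (f n) + n.  The theorem then says that
   z (f (f n) + n + 2) is n + z n or n + z n + 1.  For n = f k + c, the letter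
   counts at f (f n) + n and the letters around that place are determined by
   those for k, so they run through a finite automaton, which is explored by
   computation. *)

(** * Complementary sequences from counting functions *)

Definition complementary (u v : nat -> nat) :=
  (forall x, 0 < x -> exists n, x = u n \/ x = v n) /\
  (forall m n, u m <> v n).

(* Lambek-Moser, where c counts the terms of the sequence p below n. *)
Lemma counting_complementary (c p u v : nat -> nat) :
    (forall n, u n = n + c n + 1) -> (forall k, v k = p k + k + 2) ->
    c 0 = 0 -> (forall n, c n <= c n.+1 <= (c n).+1) ->
    (forall k, c (p k) = k /\ c (p k).+1 = k.+1) ->
  complementary u v.
Proof.
move=> uE vE c0 cS cp; have c_mono m n : m <= n -> c m <= c n.
  by apply: (homo_leq leqnn leq_trans) => i; case/andP: (cS i).
split=> [|m k]; rewrite ?uE ?vE; last first.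
  have [ck ck1] := cp k.
  by have [le_m|le_m] := leqP m (p k); have := c_mono _ _ le_m; lia.
case=> // x _; elim: x => [|x [n [|]]]; first by exists 0; left; rewrite uE c0.
  rewrite uE => def_x.
  (* After [u n] comes [u n.+1], unless [n] is a term of [p], necessarily [p (c n)]; then [v (c n)]
     comes in between. *)
  have := cS n; have [eq_c _|neq_c cSn] := eqVneq (c n.+1) (c n).
    by exists n.+1; left; rewrite uE; lia.
  have [cpn cpn1] := cp (c n); exists (c n); right.
  suff : p (c n) = n by rewrite vE; lia.
  have [/c_mono|/c_mono|//] := ltngtP (p (c n)) n; lia.
rewrite vE => def_x; exists (p n).+1; left; rewrite uE.
by have [_ ->] := cp n; lia.
Qed.

(** * P-positions from complementary sequences *)

Lemma move_sym x y x' y' : move (x, y) (x', y') -> move (y, x) (y', x').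
Proof.
case=> neq mv; split; first by case=> ey ex; apply: neq; rewrite ex ey.
case: mv => [|[[u v] [start refl]]]; first by rewrite /rook_move /=; lia.
right; exists (v, u); split.
  by case: start => -[-> ->]; [apply: Or31|apply: Or33|apply: Or32].
case: refl => [[s [le_s [-> ->]]]|[lt_uv [t [le_t [-> ->]]]]
              |[lt_vu [t [le_t [-> ->]]]]].
- by apply: Or31; exists s; rewrite minnC.
- by apply: Or33; split=> //; exists t.
- by apply: Or32; split=> //; exists t.
Qed.

(** Passing to a starting point changes the difference of the coordinates by at most 1; a diagonal
    keeps that difference, and a reflection turns it into the coordinate sum of the target. *)
Lemma move_bounds x y x' y' : move (x, y) (x', y') ->
  (x', y') <> (x, y) /\
  [\/ x' = x \/ y' = y,
      y + x' <= y' + x + 1 /\ y' + x <= y + x' + 1,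
      x + (x' + y') <= y + 1 /\ y <= x + (x' + y') + 1
    | y + (x' + y') <= x + 1 /\ x <= y + (x' + y') + 1].
Proof.
case=> neq mv; split=> //.
case: mv => [|[[u v] [start refl]]].
  by rewrite /rook_move /= => rook; apply: Or41; lia.
have {}start : [\/ u = x /\ v = y, x = u.+1 /\ y = v | x = u /\ y = v.+1].
  by case: start => -[-> ->]; [apply: Or31 | apply: Or32 | apply: Or33].
case: refl => [[s [le_s [-> ->]]]|[lt_uv [t [le_t [-> ->]]]]
              |[lt_vu [t [le_t [-> ->]]]]].
- by apply: Or42; case: start; lia.
- by apply: Or43; case: start; lia.
- by apply: Or44; case: start; lia.
Qed.

Definition listed (a b : nat -> nat) (p : position) :=
  p = (0, 0) \/ exists n, p = (a n, b n) \/ p = (b n, a n).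

Lemma listed_sym a b x y : listed a b (x, y) -> listed a b (y, x).
Proof.
case=> [[-> ->]|[n [[-> ->]|[-> ->]]]]; first by left.
  by right; exists n; right.
by right; exists n; left.
Qed.

(** The differences [2 d] and the sums [2 s] are even, so the tolerance of 1 in [move_bounds] leaves
    only equalities, which injectivity and disjointness exclude. Conversely, the coverings yield a
    move from each unlisted position. *)
Lemma listed_P_position (a b d s : nat -> nat) :
    (forall n, b n = a n + d n + d n) -> (forall n, s n = a n + d n) ->
    {homo a : m n / m < n} -> {homo d : m n / m < n} ->
    (forall n, 0 < a n) -> (forall n, 0 < d n) ->
    complementary a b -> complementary d s ->
  forall p, P_position p <-> listed a b p.
Proof.
move=> bE sE a_mono d_mono a_gt0 d_gt0 [ab_cover ab_disj] [ds_cover ds_disj] p.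
have a_inj m n : a m = a n -> m = n.
  by have [/a_mono|/a_mono|//] := ltngtP m n; lia.
have d_inj m n : d m = d n -> m = n.
  by have [/d_mono|/d_mono|//] := ltngtP m n; lia.
have b_mono : {homo b : m n / m < n}.
  move=> m n lt_mn; have := a_mono _ _ lt_mn; have := d_mono _ _ lt_mn.
  by rewrite !bE; lia.
have b_inj m n : b m = b n -> m = n.
  by have [/b_mono|/b_mono|//] := ltngtP m n; lia.
have no_move n q : listed a b q -> ~ move (a n, b n) q.
  have an := a_gt0 n; have dn := d_gt0 n.
  have bn : b n = a n + d n + d n by exact: bE.
  case=> [->|[m [->|->]]] /move_bounds[neq].
  - by case; lia.
  - have neq_mn : m <> n by move=> eq_mn; apply: neq; rewrite eq_mn.
    have neq_a : a m <> a n by move/a_inj.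
    have neq_b : b m <> b n by move/b_inj.
    have neq_d : d m <> d n by move/d_inj.
    have neq_s := @ds_disj n m; rewrite sE in neq_s.
    have bm : b m = a m + d m + d m by exact: bE.
    by case; lia.
  - have neq_ab := @ab_disj n m; have neq_ba := @ab_disj m n.
    have neq_s := @ds_disj n m; rewrite sE in neq_s.
    have bm : b m = a m + d m + d m by exact: bE.
    by have dm := d_gt0 m; case; lia.
have has_move x y : x <= y -> ~ listed a b (x, y) ->
    exists q, move (x, y) q /\ listed a b q.
  move=> le_xy not_listed.
  have [x0|x_gt0] := posnP x.
    exists (0, 0); split; last by left.
    have [y0|y_gt0] := posnP y; first by case: not_listed; left; rewrite x0 y0.
    by rewrite x0; split; [case; lia | left; right].
  have [n [def_x|def_x]] := ab_cover x x_gt0.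
    have [lt_by|lt_yb|eq_y] := ltngtP (b n) y; last first.
    - by case: not_listed; right; exists n; left; rewrite def_x eq_y.
    - have [j [r [def_y le_r]]] : exists j r, y = x + j + j + r /\ r <= 1.
        exists (y - x)./2, (odd (y - x)).
        by have := odd_double_half (y - x); lia.
      (* One of the starting points has an even difference, as all listed
         positions do. *)
      have start : starting_point (x, y) (x, x + j + j).
        have [r0|r1] : r = 0 \/ r = 1 by lia.
          by apply: Or31; rewrite def_y r0 addn0.
        by apply: Or33; rewrite /= def_y r1 addn1.
      have [j0|j_gt0] := posnP j.
        exists (0, 0); split; last by left.
        split; first by case; lia.
        right; exists (x, x + j + j); split=> //; apply: Or31; exists x.
        by split; [lia | congr pair; lia].
      have [m [def_j|def_j]] := ds_cover j j_gt0; rewrite ?sE in def_j;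
        have bm : b m = a m + d m + d m by exact: bE.
        have lt_d : d m < d n by rewrite bE in lt_yb; lia.
        have lt_mn : m < n.
          have [//|/d_mono|eq_mn] := ltngtP m n; first by lia.
          by rewrite eq_mn in lt_d; lia.
        have lt_a := a_mono _ _ lt_mn.
        exists (a m, b m); split; last by right; exists m; left.
        split; first by case; lia.
        right; exists (x, x + j + j); split=> //; apply: Or31; exists (x - a m).
        by split; [lia | congr pair; lia].
      have am := a_gt0 m; exists (a m, b m).
      split; last by right; exists m; left.
      split; first by case; lia.
      right; exists (x, x + j + j); split=> //; apply: Or32.
      split; first by lia.
      by exists (a m); split; [lia | congr pair; lia].
    exists (a n, b n); split; last by right; exists n; left.
    by split; [case; lia | left; right; rewrite def_x].
  exists (b n, a n); split; last by right; exists n; right.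
  have := d_gt0 n; have : b n = a n + d n + d n by exact: bE.
  by split; [case; lia | left; right; split=> //=; lia].
apply: iff_sym; apply: P_position_unique p => -[x y]; split=> [|no_q].
  case=> [[-> ->] [q [/no_move0 //]]|[n [[-> ->]|[-> ->]]]] [q [mv_q lq]].
    exact: no_move lq mv_q.
  case: q mv_q lq => x' y' /move_sym mv_q /listed_sym lq.
  exact: no_move lq mv_q.
apply: NNPP => not_listed; apply: no_q.
have [le_xy|/ltnW le_yx] := leqP x y; first exact: has_move.
have [|[x' y'] [mv lq]] := has_move _ _ le_yx; first by move/listed_sym.
by exists (y', x'); split; [exact: move_sym | exact: listed_sym].
Qed.

(** * The Tribonacci morphism and its fixed point *)

Definition tau (u : seq nat) : seq nat :=
  flatten [seq match c with 0 => [:: 0; 1] | 1 => [:: 0; 2] | _ => [:: 0] end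
          | c <- u].

Definition count0 (u : seq nat) := count (pred1 0) u.
Definition count1 (u : seq nat) := count (pred1 1) u.
(** Letters above 1 all count as 2, like in the default case of [tau], so that the identities below
    hold for every word. *)
Definition count2 (u : seq nat) := count (fun c => 1 < c) u.

Lemma tau_cat u v : tau (u ++ v) = tau u ++ tau v.
Proof. by rewrite /tau map_cat flatten_cat. Qed.

Lemma count0_cat u v : count0 (u ++ v) = count0 u + count0 v.
Proof. exact: count_cat. Qed.

Lemma count1_cat u v : count1 (u ++ v) = count1 u + count1 v.
Proof. exact: count_cat. Qed.

Lemma count2_cat u v : count2 (u ++ v) = count2 u + count2 v.
Proof. exact: count_cat. Qed.

Lemma size_counts u : size u = count0 u + count1 u + count2 u.
Proof.
by elim: u => //= -[|[|c]] u; rewrite /count0 /count1 /count2 /=; lia.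
Qed.

(** Each image contains exactly one 0; a 1 arises only from a 0, and a 2 only from a 1. *)
Lemma counts_tau u :
  [/\ count0 (tau u) = size u, count1 (tau u) = count0 u
    & count2 (tau u) = count1 u].
Proof.
elim: u => //= c u [IH0 IH1 IH2].
rewrite -cat1s tau_cat !count0_cat !count1_cat !count2_cat IH0 IH1 IH2.
by case: c => [|[|c]].
Qed.

Lemma size_tau u : size (tau u) = size u + count0 u + count1 u.
Proof. by rewrite size_counts; have [-> -> ->] := counts_tau u. Qed.

Definition trib_iter k := iter k tau [:: 0].

(** The iterates extend each other and the [n]-th is longer than [n], so the default 0 is never
    reached. *)
Definition trib n := nth 0 (trib_iter n) n.

Definition trib_prefix n := mkseq trib n.

Lemma trib_iterS k : trib_iter k.+1 = tau (trib_iter k).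
Proof. by []. Qed.

Lemma trib_iter_ext k m : k <= m -> exists v, trib_iter m = trib_iter k ++ v.
Proof.
have ext1 j : exists v, trib_iter j.+1 = trib_iter j ++ v.
  elim: j => [|j [v IHj]]; first by exists [:: 1].
  by exists (tau v); rewrite trib_iterS {1}IHj tau_cat.
move=> /subnKC <-; elim: (m - k) => [|j [v IHj]].
  by exists [::]; rewrite addn0 cats0.
have [w extj] := ext1 (k + j).
by exists (v ++ w); rewrite addnS extj IHj catA.
Qed.

Lemma size_trib_iter k : k < size (trib_iter k).
Proof.
elim: k => // k IHk; rewrite trib_iterS size_tau.
suff : 0 < count0 (trib_iter k) by lia.
case: k {IHk} => // k; rewrite trib_iterS.
have [-> _ _] := counts_tau (trib_iter k).
by elim: k => // k; rewrite trib_iterS size_tau; lia.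
Qed.

Lemma trib_prefix_take n k :
  n <= size (trib_iter k) -> trib_prefix n = take n (trib_iter k).
Proof.
move=> le_n; apply: (@eq_from_nth _ 0) => [|i]; rewrite size_mkseq.
  by rewrite size_takel.
move=> lt_in; rewrite nth_mkseq // nth_take // /trib.
have lt_ik := leq_trans lt_in le_n; have lt_ii := size_trib_iter i.
have [le_ik|/ltnW le_ki] := leqP i k.
  by have [v ->] := trib_iter_ext le_ik; rewrite nth_cat lt_ii.
by have [v ->] := trib_iter_ext le_ki; rewrite nth_cat lt_ik.
Qed.

Lemma trib_prefixS n : trib_prefix n.+1 = trib_prefix n ++ [:: trib n].
Proof. by rewrite cats1; exact: mkseqS. Qed.

(** The function f of the overview; [cnt0] and [cnt1] below are its y and z. *)
Definition tau_index n := size (tau (trib_prefix n)).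

Lemma tau_prefix n : tau (trib_prefix n) = trib_prefix (tau_index n).
Proof.
have le_n := ltnW (size_trib_iter n).
have tauW : trib_iter n.+1 = tau (trib_prefix n) ++ tau (drop n (trib_iter n)).
  by rewrite (trib_prefix_take le_n) -tau_cat cat_take_drop.
rewrite (@trib_prefix_take (tau_index n) n.+1) tauW.
  by rewrite take_size_cat.
by rewrite size_cat leq_addr.
Qed.

Definition cnt0 n := count0 (trib_prefix n).
Definition cnt1 n := count1 (trib_prefix n).
Definition cnt2 n := count2 (trib_prefix n).

Lemma cnt_sum n : cnt0 n + cnt1 n + cnt2 n = n.
Proof. by rewrite -size_counts size_mkseq. Qed.

Lemma tau_indexE n : tau_index n = n + cnt0 n + cnt1 n.
Proof. by rewrite /tau_index size_tau size_mkseq. Qed.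

Lemma cnt_tau_index n :
  [/\ cnt0 (tau_index n) = n, cnt1 (tau_index n) = cnt0 n
    & cnt2 (tau_index n) = cnt1 n].
Proof.
rewrite /cnt0 /cnt1 /cnt2 -tau_prefix.
by have [-> -> ->] := counts_tau (trib_prefix n); rewrite size_mkseq.
Qed.

Lemma cntS n :
  [/\ cnt0 n.+1 = cnt0 n + (trib n == 0), cnt1 n.+1 = cnt1 n + (trib n == 1)
    & cnt2 n.+1 = cnt2 n + (1 < trib n)].
Proof.
rewrite /cnt0 /cnt1 /cnt2 trib_prefixS count0_cat count1_cat count2_cat.
by rewrite /count0 /count1 /count2 /= !addn0.
Qed.

(** * Factors of the Tribonacci word *)

Definition window s w := trib_prefix (s + size w) = trib_prefix s ++ w.

Lemma take_trib_prefix m n : m <= n -> take m (trib_prefix n) = trib_prefix m.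
Proof.
move=> /subnKC <-; rewrite /trib_prefix /mkseq iotaD map_cat take_size_cat //.
by rewrite size_map size_iota.
Qed.

Lemma window_cat s u v :
  window s (u ++ v) -> window s u /\ window (s + size u) v.
Proof.
rewrite /window size_cat addnA catA => suv.
have su : trib_prefix (s + size u) = trib_prefix s ++ u.
  rewrite -(take_trib_prefix (leq_addr (size v) (s + size u))) suv.
  by rewrite take_size_cat // size_cat size_mkseq.
by rewrite suv su.
Qed.

Lemma window_slice s w i l : i <= size w -> window s w ->
  window s (take i w) /\ window (s + i) (take l (drop i w)).
Proof.
move=> le_i; rewrite -{1}(cat_take_drop i w) => /window_cat[wi].
by rewrite size_takel // -{1}(cat_take_drop l (drop i w)) => /window_cat[].
Qed.

Lemma window_tau s w : window s w -> window (tau_index s) (tau w).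
Proof.
rewrite /window => sw; rewrite -tau_prefix -tau_cat -sw tau_prefix.
by rewrite [tau_index (_ + _)]/tau_index sw tau_cat size_cat.
Qed.

Lemma window_cnt s w : window s w ->
  [/\ cnt0 (s + size w) = cnt0 s + count0 w,
      cnt1 (s + size w) = cnt1 s + count1 w
    & cnt2 (s + size w) = cnt2 s + count2 w].
Proof.
by rewrite /window /cnt0 /cnt1 /cnt2 => ->;
  rewrite count0_cat count1_cat count2_cat.
Qed.

Lemma window_trib n : window n [:: trib n].
Proof. by rewrite /window addn1 trib_prefixS. Qed.

Lemma tau_indexS n : tau_index n.+1 = tau_index n + size (tau [:: trib n]).
Proof. by rewrite /tau_index trib_prefixS tau_cat size_cat. Qed.

Lemma window_nth s w i : window s w -> i < size w -> trib (s + i) = nth 0 w i.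
Proof.
move=> sw lt_i; have := congr1 (fun u => nth 0 u (s + i)) sw.
rewrite nth_mkseq ?ltn_add2l // => ->.
by rewrite nth_cat size_mkseq ltnNge leq_addr addKn.
Qed.

Lemma window_tau_trib n : window (tau_index n) (tau [:: trib n]).
Proof. exact/window_tau/window_trib. Qed.

Lemma trib_tau_index n c : c < size (tau [:: trib n]) ->
  trib (tau_index n + c) = nth 0 (tau [:: trib n]) c.
Proof. exact/window_nth/window_tau_trib. Qed.

Lemma trib_tau_index0 n : trib (tau_index n) = 0.
Proof.
by rewrite -[tau_index n]addn0 trib_tau_index //; case: (trib n) => [|[]].
Qed.

Lemma trib_tau_index1 n : trib n = 0 -> trib (tau_index n).+1 = 1.
Proof. by move=> n0; rewrite -addn1 trib_tau_index n0. Qed.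

Lemma tau_index_decomp n :
  exists k c, c < size (tau [:: trib k]) /\ n = tau_index k + c.
Proof.
elim: n => [|n [k [c [lt_c ->]]]]; first by exists 0, 0.
have [lt_c1|] := ltnP c.+1 (size (tau [:: trib k])).
  by exists k, c.+1; rewrite addnS.
move=> le_c1; exists k.+1, 0; rewrite addn0 tau_indexS; split; last by lia.
by case: (trib k.+1) => [|[]].
Qed.

(** * The finite automaton of count deviations *)

(* In a state (a, b, u, w) for n, with m = f (f n) + n, the numbers a and b are
   the deviations of the counts of 1 and 2 before m from the values expected by
   linearity, shifted by 1 so as to be natural; u is the letter at n, and w is
   the factor from m - 1 on, as m may have to be shifted back by one letter. *)
Definition state : Type := nat * nat * nat * seq nat.

Definition is_state n (st : state) :=
  let: (a, b, u, w) := st in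
  exists s,
    [/\ s.+1 = tau_index (tau_index n) + n, window s w, trib n = u,
        cnt1 s.+1 + 1 = n + cnt1 n + a
      & cnt2 s.+1 + 1 = cnt0 n + cnt2 n + b].

(* The position of m for f k + c, relative to the image under f of the position
   m - 1 for k. *)
Definition next_pos (st : state) c :=
  let: (_, b, _, w) := st in size (tau (take 1 w)) + b + 5 * c - 1.

(** Under [tau], 0 becomes the source of 1, and 1 that of 2: the new deviation of 1 stems from the
    old one of 0, which is [2 - a - b], and the new deviation of 2 from the old one of 1. *)
Definition next_state (st : state) c : state :=
  let: (a, b, u, w) := st in
  let h := tau (take 1 w) in
  let i := next_pos st c in
  (3 + count1 (take i (tau w)) - (count1 h + a + b + c),
   a + count2 (take i (tau w)) - (count2 h + c),
   nth 0 (tau [:: u]) c,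
   take 8 (drop i.-1 (tau w))).

(** Guarantees that no subtraction in [next_state] is truncated and that the window is long
    enough. *)
Definition valid_step (st : state) c :=
  let: (a, b, u, w) := st in
  let h := tau (take 1 w) in
  let i := next_pos st c in
  [&& 0 < size w, 0 < i <= size (tau w),
      count1 h + a + b + c <= 3 + count1 (take i (tau w))
    & count2 h + c <= a + count2 (take i (tau w))].

(** Write f for [tau_index]. As [f x = 2x - cnt2 x], the position [f (f (f k)) + f k] exceeds
    [f (f (f k) + k)] by [b - 1]. The offset [c] adds [4 * c] through f applied twice, and [c]
    itself, hence the [5 * c] in [next_pos]. *)
Lemma is_state_next k st c : c < size (tau [:: trib k]) -> valid_step st c ->
  is_state k st -> is_state (tau_index k + c) (next_state st c).
Proof.
case: st => [[[a b] u] w] lt_c /= /and4P[w_gt0 /andP[i_gt0 le_i] ok1 ok2].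
case=> s [def_s sw <- dev1 dev2].
set h := tau (take 1 w) in ok1 ok2 *.
set i := size h + b + 5 * c - 1 in i_gt0 le_i ok1 ok2 *.
have sw' := window_tau sw; exists (tau_index s + i.-1).
have [sh _] := window_slice 0 w_gt0 sw.
have size1 : size (take 1 w) = 1 by rewrite size_takel.
have fs1 : tau_index s.+1 = tau_index s + size h.
  have := window_tau sh; have := sh.
  rewrite /window size1 addn1 /tau_index => -> _.
  by rewrite tau_cat size_cat.
have [sh0 sh1 sh2] := window_cnt (window_tau sh).
rewrite -/h -fs1 in sh0 sh1 sh2.
have [si _] := window_slice 0 le_i sw'.
have [si0 si1 si2] := window_cnt si; rewrite size_takel // in si0 si1 si2.
have le_i' : i.-1 <= size (tau w) by lia.
have [_ si'] := window_slice 8 le_i' sw'.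
have [fk0 fk1 fk2] := cnt_tau_index k.
have [ffk0 ffk1 ffk2] := cnt_tau_index (tau_index k).
have [fs0' fs1' fs2'] := cnt_tau_index s.+1.
have fkE := tau_indexE k; have ffkE := tau_indexE (tau_index k).
have fffkE := tau_indexE (tau_index (tau_index k)).
have fsE := tau_indexE s.+1; have sum_s := cnt_sum s.+1.
have sum_k := cnt_sum k.
have sum_ffk := cnt_sum (tau_index (tau_index k)).
(* If [c = 1], one more letter 0 is passed, and [tau (tau [:: 0])] is 0102, of length 4. *)
have [n0 n1 n2 ffn] : [/\ cnt0 (tau_index k + c) = k + c,
    cnt1 (tau_index k + c) = cnt0 k, cnt2 (tau_index k + c) = cnt1 k
    & tau_index (tau_index (tau_index k + c))
      = tau_index (tau_index (tau_index k)) + 4 * c].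
  have : c <= 1 by move: lt_c; case: (trib k) => [|[]] /=; lia.
  case: c {lt_c ok1 ok2 i i_gt0 le_i si si0 si1 si2 le_i' si'} => [|[|//]] _.
    by rewrite !addn0.
  have t0 := trib_tau_index0 k; have t1 := trib_tau_index0 (tau_index k).
  have t2 := trib_tau_index1 t0.
  have [] := cntS (tau_index k); rewrite t0 /= => e0 e1 e2.
  rewrite !addn1 tau_indexS t0 -[size _]/2 addn2 !tau_indexS t1 t2.
  by rewrite e0 e1 e2 -addnA; split=> //; lia.
rewrite n0 n1 n2 ffn.
have -> : (tau_index s + i.-1).+1 = tau_index s + i by lia.
by split=> //; first [exact: trib_tau_index | rewrite ?si1 ?si2; lia].
Qed.

(** The state for [n = 1], where [m = 5]. For [n = 0] there is none, as no letter precedes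
    [m = 0]. *)
Definition init_state : state := (1, 1, 1, [:: 0; 1; 0; 0; 1; 0; 2; 0]).

Definition letter_of (st : state) := let: (_, _, u, _) := st in u.

Definition next_states (st : state) :=
  [seq next_state st c | c <- iota 0 (size (tau [:: letter_of st]))].

(* Nine rounds of exploration reach all the states; length 8 is the shortest
   for which the factors determine their successors. *)
Definition states :=
  iter 9 (fun sts => undup (sts ++ flatten (map next_states sts)))
    [:: init_state].

(** The two letters counted are those at [m] and [m + 1], since [w] starts at [m - 1]; the bounds
    include the shift of [a] by 1. *)
Definition good_state (st : state) :=
  let: (a, _, _, w) := st in
  (2 < size w) && (1 <= a + count1 (take 2 (drop 1 w)) <= 2).

Lemma states_closed :
  all (fun st => all (fun c => valid_step st c && (next_state st c \in states))
                     (iota 0 (size (tau [:: letter_of st])))) states.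
Proof. by vm_compute. Qed.

Lemma states_good : all good_state states.
Proof. by vm_compute. Qed.

(** Strong induction along [n = tau_index k + c], where [n > 1] forces [0 < k < n]. *)
Lemma states_cover n : 0 < n -> exists2 st, st \in states & is_state n st.
Proof.
have [m] := ubnP n; elim: m n => // m IHm n lt_nm n_gt0.
have [n1|n_gt1] : n = 1 \/ 1 < n by lia.
  rewrite n1; exists init_state; first by vm_compute.
  by exists 4; split; vm_compute.
have [k [c [lt_c def_n]]] := tau_index_decomp n.
have k_gt0 : 0 < k.
  case: k lt_c def_n => // lt_c; rewrite /tau_index /=.
  by move: lt_c => /=; lia.
have lt_kn : k < n.
  rewrite def_n tau_indexE; suff : 0 < cnt0 k by lia.
  by case: k k_gt0 {lt_c def_n}.
have [|st st_in st_k] := IHm k _ k_gt0; first by lia.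
have u_k : letter_of st = trib k.
  by case: st st_k {st_in} => [[[? ?] ?] ?] [? []].
have := allP states_closed _ st_in; rewrite u_k.
move=> /allP/(_ c); rewrite mem_iota leq0n add0n.
move=> /(_ lt_c) /andP[ok in_states].
exists (next_state st c); first exact: in_states.
by rewrite def_n; apply: is_state_next.
Qed.

Lemma cnt1_deviation n :
  let d := cnt1 (tau_index (tau_index n) + n + 2) in
  d = n + cnt1 n \/ d = n + cnt1 n + 1.
Proof.
have [->|/states_cover] := posnP n; first by right; vm_compute.
move=> [st /(allP states_good)]; case: st => [[[a b] u] w] /=.
move=> /andP[w_gt2 good] [s [def_s sw _ dev1 _]].
have [|_ sw'] := @window_slice s w 1 2 _ sw; first by lia.
have [_ c1 _] := window_cnt sw'.
have size2 : size (take 2 (drop 1 w)) = 2.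
  by rewrite size_takel // size_drop ltn_subRL.
rewrite size2 addn1 in c1; rewrite -def_s c1; lia.
Qed.

(** * The explicit P-positions *)

(* Indexed from 0, so that seq_a n is the term a (n + 1) of the theorem. *)
Definition seq_a n := n + cnt1 n + 1.
Definition seq_b n := tau_index (tau_index n) + n + 3.
Definition seq_d n := n + cnt0 n + 1.
Definition seq_s n := tau_index n + n + 2.

Lemma seq_bE n : seq_b n = seq_a n + seq_d n + seq_d n.
Proof.
rewrite /seq_a /seq_b /seq_d (tau_indexE (tau_index n)).
by have [-> -> _] := cnt_tau_index n; rewrite tau_indexE; lia.
Qed.

Lemma seq_sE n : seq_s n = seq_a n + seq_d n.
Proof. by rewrite /seq_a /seq_s /seq_d tau_indexE; lia. Qed.

Lemma seq_a_mono : {homo seq_a : m n / m < n}.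
Proof.
apply: (homo_ltn ltn_trans) => n.
by rewrite /seq_a; have [_ -> _] := cntS n; lia.
Qed.

Lemma seq_d_mono : {homo seq_d : m n / m < n}.
Proof.
apply: (homo_ltn ltn_trans) => n.
by rewrite /seq_d; have [-> _ _] := cntS n; lia.
Qed.

(** Counting from 0, the [k]-th 0 is at [tau_index k], and the [k]-th 1 is the second letter of its
    image. *)
Lemma seq_ab_complementary : complementary seq_a seq_b.
Proof.
apply: (@counting_complementary cnt1 (fun k => (tau_index (tau_index k)).+1))
  => // [k|n|k]; first by rewrite /seq_b; lia.
  by have [_ -> _] := cntS n; lia.
have t0 := trib_tau_index0 (tau_index k).
have t1 := trib_tau_index1 (trib_tau_index0 k).
have [_ -> _] := cntS (tau_index (tau_index k)).+1; rewrite t1.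
have [_ -> _] := cntS (tau_index (tau_index k)); rewrite t0.
have [_ -> _] := cnt_tau_index (tau_index k); have [-> _ _] := cnt_tau_index k.
by lia.
Qed.

Lemma seq_ds_complementary : complementary seq_d seq_s.
Proof.
apply: (@counting_complementary cnt0 tau_index) => // [n|k].
  by have [-> _ _] := cntS n; lia.
have [-> _ _] := cntS (tau_index k); have [-> _ _] := cnt_tau_index k.
by rewrite trib_tau_index0 addn1.
Qed.

Lemma P_position_seq p : P_position p <-> listed seq_a seq_b p.
Proof.
apply: listed_P_position p; [exact: seq_bE | exact: seq_sE | exact: seq_a_mono
  | exact: seq_d_mono | by move=> n; rewrite /seq_a addn1
  | by move=> n; rewrite /seq_d addn1 | exact: seq_ab_complementary
  | exact: seq_ds_complementary].
Qed.

(** * Uniqueness of the list and the theorem *)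

Lemma increasing_range_le (u v : nat -> nat) :
    {homo u : m n / m < n} -> {homo v : m n / m < n} ->
    (forall m, exists n, v m = u n) ->
  forall n, u n <= v n.
Proof.
move=> u_mono v_mono sub_vu.
have u_le m n : m <= n -> u m <= u n by exact: (ltnW_homo u_mono).
elim=> [|n IHn]; first by have [k ->] := sub_vu 0; apply: u_le.
have [k def_k] := sub_vu n.+1; have := v_mono n n.+1 (ltnSn n).
rewrite def_k => lt_v; have [/u_le//|] := leqP n.+1 k.
rewrite ltnS => /u_le le_u.
by have := leq_trans lt_v (leq_trans le_u IHn); rewrite ltnn.
Qed.

Lemma lists_P_positions_seq a b : lists_P_positions a b ->
  forall n, a n.+1 = seq_a n /\ b n.+1 = seq_b n.
Proof.
case=> list_P list_all a_mono.
have lt_ab k : seq_a k < seq_b k by rewrite seq_bE /seq_d; lia.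
have in_seq n : exists k, a n.+1 = seq_a k /\ b n.+1 = seq_b k.
  have [/P_position_seq[[]|[k [[-> ->]|[eq_a eq_b]]]] le_ab] := list_P n.+1 isT.
  - by lia.
  - by exists k.
  - by have := lt_ab k; lia.
have a1_mono : {homo (fun n => a n.+1) : m n / m < n}.
  by move=> m n lt_mn; apply: a_mono.
(* Both sequences increase and have the same range, so each bounds the other. *)
have a_eq n : a n.+1 = seq_a n.
  apply/eqP; rewrite eqn_leq; apply/andP; split.
    apply: (increasing_range_le a1_mono seq_a_mono) => k.
    have [||[|m] [// _ eq_a _]] := list_all (seq_a k) (seq_b k).
    - by apply/P_position_seq; right; exists k; left.
    - by rewrite /seq_a; have := lt_ab k; rewrite /seq_a; lia.
    - by exists m.
  apply: (increasing_range_le seq_a_mono a1_mono) => k.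
  by have [m [-> _]] := in_seq k; exists m.
move=> n; split=> //; have [k [eq_a ->]] := in_seq n.
congr seq_b; move: eq_a; rewrite a_eq.
by have [/seq_a_mono|/seq_a_mono|//] := ltngtP n k; lia.
Qed.

Theorem theorem3 :
  (exists a b : nat -> nat, lists_P_positions a b) /\
  (forall a b : nat -> nat, lists_P_positions a b ->
     forall n : nat, 0 < n ->
       a (b n) = a n + b n \/ a (b n) = a n + b n - 1).
Proof.
split=> [|a b /lists_P_positions_seq list_ab [//|n] _].
  exists (fun n => seq_a n.-1), (fun n => seq_b n.-1); split.
  - case=> // n _; split; first by apply/P_position_seq; right; exists n; left.
    by rewrite seq_bE /seq_a; lia.
  - move=> x y /P_position_seq[[-> ->] //|[n [[-> ->]|[-> ->]]]] le_xy.
      by exists n.+1.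
    by move: le_xy; rewrite seq_bE /seq_d; lia.
  - by case=> // m [//|n] _ lt_mn; apply: seq_a_mono.
have [-> ->] := list_ab n.
(* With indices from 1, the term of [a] at [seq_b n] is [seq_a] at one less, which is the argument
   in [cnt1_deviation]. *)
have -> : seq_b n = (tau_index (tau_index n) + n + 2).+1 by rewrite /seq_b; lia.
have [-> _] := list_ab (tau_index (tau_index n) + n + 2).
by have := cnt1_deviation n; rewrite /seq_a /=; lia.
Qed.
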